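(* Let $A\subseteq \mathbb{N}$ be a set with $|A| = 6$. Then $A$ is not sum-dominant, i.e. $|A+A|\le |A-A|$.
   Context: For a finite set $A\subseteq\mathbb{N}$, the sum set is $A+A=\{a_i+a_j : a_i,a_j\in A\}$ and the difference set is $A-A=\{a_i-a_j : a_i,a_j\in A\}$. The set $A$ is called sum-dominant if $|A+A|>|A-A|$. *)

(* Defs.v *)
From mathcomp Require Import all_boot all_order all_algebra.
From mathcomp Require Import finmap.
Set Implicit Arguments. Unset Strict Implicit. Unset Printing Implicit Defensive.
Local Open Scope fset_scope.

Definition sumset (A : {fset nat}) : {fset nat} :=
  [fset (a + b)%N | a in A, b in A].

Definition diffset (A : {fset nat}) : {fset int} :=
  [fset (a%:Z - b%:Z)%R | a in A, b in A].

Definition sum_dominant (A : {fset nat}) : Prop :=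
  (#|` diffset A| < #|` sumset A|)%N.

(* Main.v *)
(** Write [a_0 < ... < a_5] for the elements of [A] and use the five positive
    gaps [a_(i+1) - a_i] as unknowns; the differences [a_j - a_i] and the sums
    [a_i + a_j - 2 a_0] are linear forms in these gaps.  Since
    [|A - A| = 2 D + 1], where [D] is the number of positive differences, and
    since every coincidence among sums is a coincidence among differences, it
    suffices to run through the positive differences one at a time: each one is
    either new, or equal to an earlier one, which yields a linear equation
    between the gaps.  An equation whose coefficients all have the same sign is
    impossible.  On every branch of this search, the sums that are distinct
    modulo the equations eventually number at most [2 D' + 1], where [D'] is the
    number of differences found to be distinct; a few hundred branches are
    enough. *)
Require Import Defs.
From mathcomp Require Import all_boot all_order all_algebra.
From mathcomp Require Import finmap zify ring.
Local Open Scope fset_scope.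

Import GRing.Theory Num.Theory Order.TTheory.

Section LinearForms.
Set Implicit Arguments.
Unset Strict Implicit.
Local Open Scope ring_scope.

(** A list stands for the linear form with these coefficients, followed by
    infinitely many zeros. *)
Implicit Types (e f d : seq int) (W reps rem : seq (seq int)) (x : nat -> int).

Fixpoint dot f x : int :=
  if f is c :: f' then c * x 0%N + dot f' (x \o succn) else 0.

Fixpoint comb (a : int) e (b : int) f : seq int :=
  match e, f with
  | [::], _ => [seq b * v | v <- f]
  | _, [::] => [seq a * u | u <- e]
  | u :: e', v :: f' => (a * u + b * v) :: comb a e' b f'
  end.

Lemma dot_scale a f x : dot [seq a * u | u <- f] x = a * dot f x.
Proof. by elim: f x => [|u f IH] x /=; rewrite ?mulr0 // IH; ring. Qed.

Lemma dot_comb a e b f x : dot (comb a e b f) x = a * dot e x + b * dot f x.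
Proof.
elim: e f x => [|u e IH] [|v f] x /=; rewrite ?dot_scale ?IH; ring.
Qed.

Definition isnull f := all (pred1 0) f.

Definition definite f :=
  (all (fun u => 0 <= u) f || all (fun u => u <= 0) f) && ~~ isnull f.

Lemma dot_null f x : isnull f -> dot f x = 0.
Proof.
by elim: f x => //= u f IH x /andP[/eqP-> /IH->]; rewrite mul0r addr0.
Qed.

Lemma dot_ge0 f x : (forall i, 0 < x i) -> all (fun u => 0 <= u) f ->
  0 <= dot f x ?= iff isnull f.
Proof.
elim: f x => [|u f IH] x x_gt0 /=; first by move=> _; split.
case/andP=> u_ge0 /IH {}IH.
have {}IH := IH (x \o succn) (fun i => x_gt0 i.+1).
have ux_ge0 : 0 <= u * x 0%N by rewrite mulr_ge0 // ltW.
split; first by rewrite addr_ge0 // IH.1.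
rewrite eq_sym paddr_eq0 ?IH.1 // mulf_eq0 (gt_eqF (x_gt0 0%N)) orbF.
by rewrite -IH.2 [0 == dot _ _]eq_sym.
Qed.

Lemma dot_definite f x :
  (forall i, 0 < x i) -> definite f -> dot f x != 0.
Proof.
move=> x_gt0 /andP[/orP[f_ge0|f_le0] f_neq0].
  by rewrite eq_sym (dot_ge0 x_gt0 f_ge0).2.
have nf_ge0 : all (fun u => 0 <= u) [seq -1 * u | u <- f].
  by rewrite all_map; apply: sub_all f_le0 => u /=; rewrite mulN1r oppr_ge0.
have := (dot_ge0 x_gt0 nf_ge0).2.
rewrite dot_scale mulN1r eq_sym oppr_eq0 => ->.
rewrite /isnull all_map; apply: contra f_neq0; apply: sub_all => u /=.
by rewrite mulN1r oppr_eq0.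
Qed.

(** Without this normalisation the coefficients, which are computed in unary,
    become too large. *)
Definition primitive f :=
  let g : int := foldr (fun u n => gcdn `|u|%N n) 0%N f in
  let f' := [seq (u %/ g)%Z | u <- f] in
  if (g != 0) && ([seq g * u | u <- f'] == f) then f' else f.

Lemma dot_primitive f x : (dot (primitive f) x == 0) = (dot f x == 0).
Proof.
rewrite /primitive; case: ifP => // /andP[g_neq0 /eqP Df].
by rewrite -[f in RHS]Df dot_scale mulf_eq0 (negPf g_neq0).
Qed.

(** Fraction-free elimination, the pivot of [e] being its first nonzero coefficient. For a null [e]
    the index [p] is out of range, and the default coefficient 0 leaves [f] unchanged. *)
Definition elim_form e f :=
  let p := find (fun u => u != 0) e in
  if (e`_p == 0) || (f`_p == 0) then f
  else primitive (comb e`_p f (- f`_p) e).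

(** One pass suffices: [search] keeps [W] fully reduced, no form in it involving the pivot of
    another. *)
Definition reduce W f := foldl (fun g e => elim_form e g) f W.

Lemma dot_elim e f x :
  dot e x = 0 -> (dot (elim_form e f) x == 0) = (dot f x == 0).
Proof.
rewrite /elim_form => e0; case: ifPn => // /norP[ep _].
by rewrite dot_primitive dot_comb e0 mulr0 addr0 mulf_eq0 (negPf ep).
Qed.

Lemma dot_reduce W f x : {in W, forall e, dot e x = 0} ->
  (dot (reduce W f) x == 0) = (dot f x == 0).
Proof.
rewrite /reduce; elim: W f => //= e W IH f W0.
rewrite IH ?dot_elim // => [|e' e'W]; apply: W0; rewrite inE ?eqxx //.
by rewrite e'W orbT.
Qed.

Definition sub_form f e := comb 1 f (-1) e.

Lemma dot_sub f e x : dot (sub_form f e) x = dot f x - dot e x.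
Proof. by rewrite dot_comb; ring. Qed.

Definition reps_mod W fs : seq (seq int) :=
  foldr (fun f L => if has (fun g => isnull (reduce W (sub_form f g))) L
                    then L else f :: L) [::] fs.

(** Merged forms agree at [x]; unmerged ones may agree too, whence only an upper bound. *)
Lemma size_reps_mod W fs x : {in W, forall e, dot e x = 0} ->
  (size (undup [seq dot f x | f <- fs]) <= size (reps_mod W fs))%N.
Proof.
move=> W0; rewrite -(size_map (dot^~ x) (reps_mod W fs)).
apply: uniq_leq_size (undup_uniq _) _ => v; rewrite mem_undup.
elim: fs v => //= f fs IH v; rewrite inE => /orP[/eqP->{v}|/IH {}IH].
  case: ifP => [/hasP[g gL /dot_null-/(_ x)/eqP]|_]; last exact: mem_head.
  by rewrite dot_reduce // dot_sub subr_eq0 => /eqP->; apply: map_f.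
by case: ifP => // _; rewrite inE IH orbT.
Qed.

(** Conditionals instead of boolean connectives, whose two arguments would be
    evaluated by [vm_compute]. *)
Fixpoint search (sums : seq (seq int)) W reps rem : bool :=
  if (size (reps_mod W sums) <= (size reps).*2.+1)%N then true else
  if rem is d :: rem' then
    let eqs := [seq reduce W (sub_form d r) | r <- reps] in
    if has isnull eqs then search sums W reps rem' else
    if search sums W (d :: reps) rem' then
      all (fun e =>
             if definite e then true else
             let W' := e :: [seq elim_form e w | w <- W] in
             if has definite W' then true else search sums W' reps rem') eqs
    else false
  else false.

(** Since [reps] takes distinct values at [x], its size bounds the number of distinct differences
    from below. At each [d], the induction follows a branch whose equations hold at [x]. *)
Lemma search_sound sums diffs W reps rem x :
  (forall i, 0 < x i) -> {in W, forall e, dot e x = 0} ->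
  uniq [seq dot f x | f <- reps] ->
  {subset reps <= diffs} -> {subset rem <= diffs} ->
  search sums W reps rem ->
  (size (undup [seq dot f x | f <- sums]) <=
   (size (undup [seq dot f x | f <- diffs])).*2.+1)%N.
Proof.
move=> x_gt0; elim: rem W reps => [|d rem IH] W reps W0 Ureps sreps srem /=;
  case: ifP => [small _|_] //.
1,2: apply: leq_trans (size_reps_mod sums W0) (leq_trans small _);
  rewrite ltnS leq_double -(size_map (dot^~ x) reps);
  apply: uniq_leq_size => // _ /mapP[r /sreps rD ->];
  by rewrite mem_undup map_f.
have srem' : {subset rem <= diffs}.
  by move=> f fr; apply: srem; rewrite inE fr orbT.
case: ifP => [_|_]; first exact: IH.
case: ifP => // search_new /allP search_eq.
have [/mapP[r rR dr]|dN] := boolP (dot d x \in [seq dot f x | f <- reps]).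
  have e0 : dot (reduce W (sub_form d r)) x = 0.
    by apply/eqP; rewrite dot_reduce // dot_sub dr subrr.
  have /= := search_eq _ (map_f (fun r => reduce W (sub_form d r)) rR).
  set e := reduce W _ in e0 *.
  have W'0 : {in e :: [seq elim_form e w | w <- W], forall e', dot e' x = 0}.
    move=> e'; rewrite inE => /orP[/eqP->//|/mapP[w wW ->]].
    by apply/eqP; rewrite dot_elim // W0.
  (* The branch followed is never pruned: a definite form cannot vanish at positive gaps. *)
  have def0 e' : e' \in e :: [seq elim_form e w | w <- W] -> ~~ definite e'.
    by move=> /W'0 e'0; apply/negP => /(dot_definite x_gt0); rewrite e'0.
  rewrite (negPf (def0 _ (mem_head _ _))).
  case: ifP => [/hasP[e' e'W]|_]; last exact: IH.
  by rewrite (negPf (def0 _ _)) // inE e'W orbT.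
apply: IH search_new => //=; first by rewrite dN.
move=> f; rewrite inE => /orP[/eqP->|/sreps//].
by apply: srem; rewrite mem_head.
Qed.

End LinearForms.

(** The form of [a_i - a_0], a sum of the first [i] gaps. *)
Definition pt (i : nat) : seq int := nseq i 1%R.

Definition sums6 : seq (seq int) :=
  [seq comb 1 (pt i) 1 (pt j) | i <- iota 0 6, j <- iota i (6 - i)].

Definition diffs6 : seq (seq int) :=
  [seq sub_form (pt j) (pt i) | i <- iota 0 6, j <- iota i.+1 (5 - i)].

Lemma search6 : search sums6 [::] [::] diffs6.
Proof. by vm_compute. Qed.

(** The value 1 past the last gap makes all unknowns positive, as [search_sound] requires. *)
Definition gap (s : seq nat) (i : nat) : int :=
  if (i.+1 < size s)%N then ((nth 0 s i.+1)%:Z - (nth 0 s i)%:Z)%R else 1%R.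

Lemma gap_gt0 s i : sorted ltn s -> (0 < gap s i)%R.
Proof.
rewrite /gap => s_sorted; case: ifP => // lt_i.
rewrite subr_gt0 ltz_nat.
by apply: (sorted_ltn_nth ltn_trans) => //; rewrite inE // ltnW.
Qed.

Lemma dot_pt_gap s i : (i < size s)%N ->
  dot (pt i) (gap s) = ((nth 0 s i)%:Z - (nth 0 s 0)%:Z)%R.
Proof.
rewrite /pt => lt_i.
(* Induction peels off the first gap and so shifts [x]; hence a statement about the last [k] gaps
   before index [i]. *)
have shift k x : (forall j, (j < k)%N ->
    x j = ((nth 0 s (i - k + j).+1)%:Z - (nth 0 s (i - k + j))%:Z)%R) ->
    (k <= i)%N ->
    dot (nseq k 1%R) x = ((nth 0 s i)%:Z - (nth 0 s (i - k))%:Z)%R.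
  elim: k x => [|k IH] x xE le_k /=; first by rewrite subn0 subrr.
  rewrite mul1r IH ?(ltnW le_k) // => [|j lt_j].
    by rewrite xE // addn0 subnSK //; ring.
  by rewrite /= xE // -addSnnS subnSK.
rewrite (shift i) ?subnn // => j lt_j.
by rewrite /gap (leq_ltn_trans lt_j lt_i) add0n.
Qed.

Theorem theorem1 (A : {fset nat}) :
  #|` A| = 6%N -> ~ sum_dominant A /\ (#|` sumset A| <= #|` diffset A|)%N.
Proof.
move=> cardA; suff le_AA: (#|` sumset A| <= #|` diffset A|)%N.
  by split; rewrite // /sum_dominant ltnNge le_AA.
pose s := sort leq A.
have size_s : size s = 6 by rewrite size_sort.
have s_sorted : sorted ltn s.
  rewrite ltn_sorted_uniq_leq sort_uniq fset_uniq.
  exact: sort_sorted leq_total _.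
have memA a : (a \in A) = (a \in s) by rewrite mem_sort.
pose a i := nth 0 s i; pose x := gap s.
have aA i : (i < 6)%N -> a i \in A by move=> i6; rewrite memA mem_nth ?size_s.
have aP b : b \in A -> exists2 i, (i < 6)%N & b = a i.
  rewrite memA => bs; exists (index b s); first by rewrite -size_s index_mem.
  by rewrite /a nth_index.
have x_gt0 i : (0 < x i)%R by apply: gap_gt0.
have ptE i : (i < 6)%N -> dot (pt i) x = ((a i)%:Z - (a 0)%:Z)%R.
  by rewrite -size_s; apply: dot_pt_gap.
pose S := undup [seq dot f x | f <- sums6].
pose D := undup [seq dot f x | f <- diffs6].
have le_SD : (size S <= (size D).*2.+1)%N.
  by apply: (search_sound x_gt0 _ _ _ _ search6).
(* Translation by [2 a_0] turns the values in [S] back into sums; [absz] only returns these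
   nonnegative integers to [nat]. *)
have le_S : (#|` sumset A| <= size S)%N.
  rewrite -(size_map (fun v : int => absz (v + ((a 0)%:Z + (a 0)%:Z))%R) S).
  apply: uniq_leq_size => [|c]; first exact: fset_uniq.
  case/imfset2P => b1 /= /aP[i i6 ->] [b2 /= /aP[j j6 ->] ->{c b1 b2}].
  (* [sums6] lists only the pairs with [i <= j]. *)
  wlog le_ij : i j i6 j6 / (i <= j)%N.
    by move=> H; case/orP: (leq_total i j) => ?; [|rewrite addnC]; apply: H.
  apply/mapP; exists (dot (comb 1 (pt i) 1 (pt j)) x).
    rewrite mem_undup; apply: map_f; apply/allpairsPdep.
    by exists i, j; rewrite !mem_iota; split=> //; lia.
  by rewrite dot_comb !ptE //; lia.
have D_spec v : v \in D -> (0 < v)%R /\ v \in diffset A.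
  rewrite mem_undup => /mapP[f /allpairsPdep[i [j [+ + ->]]] ->].
  rewrite !mem_iota => i6 ij; rewrite dot_sub !ptE; try lia.
  have lt_a : (a i < a j)%N.
    by apply: (sorted_ltn_nth ltn_trans) => //; rewrite ?inE ?size_s; lia.
  split; first by lia.
  apply/imfset2P; exists (a j); first by apply: aA; lia.
  by exists (a i); [apply: aA; lia | lia].
have diffN v : v \in diffset A -> (- v)%R \in diffset A.
  case/imfset2P => b bA [c cA ->].
  by apply/imfset2P; exists c => //; exists b => //; rewrite opprB.
apply: leq_trans le_S (leq_trans le_SD _).
(* Positivity of [D] keeps zero, [D] and its opposites disjoint. *)
pose T := 0%R :: D ++ [seq (- v)%R | v <- D].
have -> : (size D).*2.+1 = size T by rewrite /= size_cat size_map addnn.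
apply: uniq_leq_size => [|v]; last first.
  rewrite inE mem_cat => /or3P[/eqP->|/D_spec[]//|/mapP[w /D_spec[_ wD] ->]].
    by apply/imfset2P; exists (a 0); rewrite ?aA //; exists (a 0);
      rewrite ?aA ?subrr.
  exact: diffN.
rewrite /= mem_cat cat_uniq map_inj_uniq ?undup_uniq; last exact: oppr_inj.
rewrite /= andbT negb_or -andbA; apply/and3P; split.
- by apply/negP => /D_spec[].
- by apply/mapP => -[w /D_spec[w_gt0 _]] w0; lia.
- by apply/hasPn => _ /mapP[w /D_spec[w_gt0 _] ->]; apply/negP => /D_spec[]; lia.
Qed.
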